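(* Let $G$ be a graph of order $n$ with minimum degree $\delta(G)$ and having exactly $s$ distinct adjacency eigenvalues, and let $p$ be a positive integer with $p\leq\delta(G)$. If $s\geq n-\delta(G)+p$, then for every adjacency eigenvalue $\lambda$ of $G$ and every star set $X$ for $\lambda$ in $G$, the star complement $V(G)\setminus X$ is a $p$-dominating set of $G$.
   Context: Graphs are finite, simple and undirected; eigenvalues are those of the adjacency matrix $A(G)$, and $m_G(\lambda)$ is the multiplicity of $\lambda$. A star set for an eigenvalue $\lambda$ of $G$ is a set $X\subseteq V(G)$ with $|X|=m_G(\lambda)$ such that $\lambda$ is not an eigenvalue of the induced subgraph $G-X$ (equivalently, of the principal submatrix of $A(G)$ obtained by deleting the rows and columns indexed by $X$); $V(G)\setminus X$ is then called a star complement for $\lambda$. A set $S\subseteq V(G)$ is $p$-dominating if every vertex of $V(G)\setminus S$ is adjacent to at least $p$ vertices of $S$. *)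

(* Defs.v *)
From HB Require Import structures.
From mathcomp Require Import all_boot all_order all_algebra.

Set Implicit Arguments.
Unset Strict Implicit.
Unset Printing Implicit Defensive.

Import Order.TTheory GRing.Theory Num.Theory.

Record sgraph := SGraph {
  vertex :> finType;
  adj : rel vertex;
  adj_sym : symmetric adj;
  adj_irrefl : irreflexive adj }.

Section Graph.
Variable G : sgraph.

Definition degree (v : G) : nat := #|[set u : G | adj v u]|.

(* Degrees are < #|G|, so the default value #|G| never matters on a nonempty
   graph; for the empty graph this is 0. *)
Definition min_degree : nat := \big[minn/#|G|]_(v : G) degree v.

Definition p_dominating (p : nat) (S : {set G}) : Prop :=
  forall v : G, v \notin S -> (p <= #|[set u in S | adj v u]|)%N.

Section Induced.
Variable S : {set G}.

Definition induced_adj : rel {x : G | x \in S} :=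
  [rel u v | adj (val u) (val v)].

Fact induced_adj_sym : symmetric induced_adj.
Proof. by move=> u v; rewrite /induced_adj /= adj_sym. Qed.

Fact induced_adj_irrefl : irreflexive induced_adj.
Proof. by move=> u; rewrite /induced_adj /= adj_irrefl. Qed.

Definition induced : sgraph := SGraph induced_adj_sym induced_adj_irrefl.

End Induced.
End Graph.

Section Spectrum.
Variables (R : rcfType) (G : sgraph).

Definition adjacency : 'M[R]_#|G| :=
  \matrix_(i, j) ((adj (enum_val i) (enum_val j))%:R)%R.

Definition adj_eigenvalue (lambda : R) : bool := eigenvalue adjacency lambda.

Definition multiplicity (lambda : R) : nat := mup lambda (char_poly adjacency).

Definition num_distinct_eigenvalues (s : nat) : Prop :=
  exists r : seq R, [/\ uniq r, size r = s & r =i adj_eigenvalue].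

End Spectrum.

Definition star_set (R : rcfType) (G : sgraph) (lambda : R) (X : {set G}) :
    Prop :=
  #|X| = multiplicity G lambda /\ ~~ adj_eigenvalue (induced (~: X)) lambda.

(* Main.v *)
Require Import Defs.
From mathcomp Require Import all_boot all_order all_algebra.
From mathcomp Require Import zify.

(** Every distinct eigenvalue contributes at least one root to the
    characteristic polynomial, so [s - 1 + m(lambda) <= n].  A vertex of the
    star set [X] has at most [|X| - 1 = m(lambda) - 1 <= n - s] neighbours in
    [X], hence at least [delta - (n - s) >= p] neighbours outside [X]. *)

Import GRing.Theory.

(** Dividing [q] by the full power of ['X - a%:P] leaves a cofactor [t] that still vanishes at every
    other element of [r]. *)
Lemma uniq_roots_mup_leq (F : fieldType) (q : {poly F}) (a : F) (r : seq F) :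
  q != 0%R -> uniq r -> all (root q) r -> a \in r ->
  size r + mup a q <= size q.
Proof.
move=> q_neq0 r_uniq /allP r_root a_in_r.
have /dvdpP [t def_q] : (('X - a%:P) ^+ mup a q %| q)%R by rewrite -mup_geq.
have t_neq0 : t != 0%R.
  by apply: contraNneq q_neq0 => t0; rewrite def_q t0 mul0r.
have t_roots : all (root t) (rem a r).
  apply/allP => x; rewrite mem_rem_uniq // inE => /andP [x_neq_a /r_root].
  rewrite {1}def_q rootM => /orP [//|/rootP].
  rewrite horner_exp hornerXsubC => /eqP; rewrite expf_eq0 subr_eq0.
  by rewrite (negPf x_neq_a) andbF.
(* The bound is strict, which makes up for the removed [a]: [size r <= size t], and
   [size q = size t + mup a q]. *)
have := max_poly_roots t_neq0 t_roots (rem_uniq a r_uniq).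
rewrite size_rem // [in size q]def_q size_Mmonic ?monic_exp ?monicXsubC //.
rewrite size_exp_XsubC; case: r a_in_r {r_uniq r_root t_roots} => //= b r _.
by rewrite addnS leq_add2r.
Qed.

Lemma num_eigenvalues_multiplicity_leq {R : rcfType} {G : sgraph} {s : nat}
    {lambda : R} :
  num_distinct_eigenvalues R G s -> adj_eigenvalue G lambda ->
  s + multiplicity G lambda <= #|G|.+1.
Proof.
move=> [r [r_uniq <- r_eig]] lambda_eig.
rewrite -(size_char_poly (adjacency R G)); apply: uniq_roots_mup_leq => //.
- by rewrite -size_poly_gt0 size_char_poly.
- by apply/allP => x; rewrite r_eig => x_eig; rewrite -eigenvalue_root_char.
- by rewrite r_eig.
Qed.

Lemma min_degree_leq (G : sgraph) (v : G) : min_degree G <= degree v.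
Proof.
rewrite /min_degree; have := mem_index_enum v.
elim: (index_enum _) => // w r IHr; rewrite inE big_cons geq_min.
by case/orP => [/eqP <- | /IHr ->]; rewrite ?leqnn ?orbT.
Qed.

Lemma degree_ltn_outside (G : sgraph) (v : G) (X : {set G}) :
  v \in X -> degree v < #|[set u in ~: X | adj v u]| + #|X|.
Proof.
move=> v_in_X; rewrite /degree -(cardsID X) (cardsD1 v X) v_in_X.
rewrite addnCA add1n ltnS addnC leq_add //.
  by apply: subset_leq_card; apply/subsetP => u; rewrite !inE.
(* Without a loop at [v], its neighbours in [X] lie in [X :\ v]; this gives the strict
   inequality. *)
apply: subset_leq_card; apply/subsetP => u; rewrite !inE.
by move=> /andP [adj_vu ->]; rewrite andbT; apply: contraTneq adj_vu => ->;
  rewrite adj_irrefl.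
Qed.

Theorem theorem4p1 (R : rcfType) (G : sgraph) (s p : nat)
    (p_gt0 : 0 < p) (p_le_delta : p <= min_degree G)
    (s_eigenvalues : num_distinct_eigenvalues R G s)
    (s_ge : #|G| - min_degree G + p <= s)
    (lambda : R) (lambda_eig : adj_eigenvalue G lambda)
    (X : {set G}) (X_star : star_set lambda X) :
  p_dominating p (~: X).
Proof.
move=> v; rewrite inE negbK => v_in_X.
have := num_eigenvalues_multiplicity_leq s_eigenvalues lambda_eig.
rewrite -(proj1 X_star).
have := degree_ltn_outside _ _ _ v_in_X; have := min_degree_leq _ v.
(* The eigenvalue count gives [#|X| <= delta + 1 - p], and the strict degree bound gives
   [delta + 1 <= k + #|X|] for the number [k] of outside neighbours; hence [p <= k]. Truncation in
   [#|G| - min_degree G] is harmless, as it can only raise the value. *)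
lia.
Qed.
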